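(* Let $\lambda\neq 0$. For all integers $N\ge 1$ and $n\ge 0$, $$\sum_{i=0}^{\min(n,N)}\lambda^{i-N+1}(n)_i\,a_{N-i}(N)\,K_{n-i}^{(N+1-i)}(\lambda)=\begin{cases} N!\,(N)_n, & 0\le n\le N,\\[4pt] (-1)^N\displaystyle\sum_{\ell=0}^{n-N-1}\binom{N}{\ell}\frac{K_{n-\ell}(\lambda)}{n-\ell}\,(n)_{N+1+\ell}, & n\ge N+1.\end{cases}$$
   Context: $(x)_n$ denotes the falling factorial $x(x-1)\cdots(x-n+1)$, $(x)_0=1$. The Korobov numbers of order $m$, $K_n^{(m)}(\lambda)$, are defined by $\left(\frac{\lambda t}{(1+t)^\lambda-1}\right)^m=\sum_{n\ge0}K_n^{(m)}(\lambda)\frac{t^n}{n!}$, and $K_n(\lambda)=K_n^{(1)}(\lambda)$ are the Korobov numbers. The numbers $a_j(N)$ ($N\ge 0$, $0\le j\le N$) are defined by $a_0(0)=\frac1\lambda$, $a_0(N)=(N+\lambda-1)_{N-1}$ for $N\ge1$, and for $N\ge 1$, $1\le j\le N$ (recursively in $j$): $a_j(N)=j\lambda\sum_{i=0}^{N-j}(N+(j+1)\lambda-1)_i\,a_{j-1}(N-i-1)$. (These are the coefficients with $\frac{d^N}{dt^N}\frac{1}{(1+t)^\lambda-1}=\frac{(-1)^N\lambda}{(1+t)^N}\sum_{i=1}^{N+1}a_{i-1}(N)\big((1+t)^\lambda-1\big)^{-i}$.) *)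

(* Defs.v *)
From mathcomp Require Import all_boot all_order all_algebra.

Set Implicit Arguments.
Unset Strict Implicit.
Unset Printing Implicit Defensive.

Import GRing.Theory Num.Theory.
Local Open Scope ring_scope.

Section Defs.
Variable F : numFieldType.

Definition falling (x : F) (n : nat) : F := \prod_(i < n) (x - i%:R).

(* A formal power series \sum_n f_n t^n is represented by its coefficient
   sequence f : nat -> F. *)

Definition fps_one : nat -> F := fun n => (n == 0%N)%:R.

Definition fps_mul (f g : nat -> F) : nat -> F :=
  fun n => \sum_(i < n.+1) f i * g (n - i)%N.

Definition fps_exp (f : nat -> F) (m : nat) : nat -> F :=
  iter m (fps_mul f) fps_one.

(* f / t, for f with zero constant term *)
Definition fps_shift (f : nat -> F) : nat -> F := fun n => f n.+1.

(* The first n coefficients of f / g, for g with nonzero constant term: the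
   equation f = g q is solved for the coefficients of q one after the other. *)
Fixpoint fps_div_seq (f g : nat -> F) (n : nat) : seq F :=
  if n is k.+1 then
    let s := fps_div_seq f g k in
    rcons s ((f k - \sum_(i < k) g (k - i)%N * s`_i) / g 0%N)
  else [::].

Definition fps_div (f g : nat -> F) : nat -> F :=
  fun n => (fps_div_seq f g n.+1)`_n.

(* (1 + t)^lam = \sum_n (lam)_n t^n / n!, as a formal binomial series *)
Definition binomial_series (lam : F) : nat -> F :=
  fun n => falling lam n / n`!%:R.

Definition korobov_num (lam : F) : nat -> F := fun n => lam * (n == 1%N)%:R.

Definition korobov_den (lam : F) : nat -> F :=
  fun n => binomial_series lam n - fps_one n.

(* lam t / ((1 + t)^lam - 1); numerator and denominator both have zero constant
   term, so a factor t is cancelled first, after which the denominator has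
   constant term lam. *)
Definition korobov_gen (lam : F) : nat -> F :=
  fps_div (fps_shift (korobov_num lam)) (fps_shift (korobov_den lam)).

(* K_n^{(m)}(lam) *)
Definition korobov (m n : nat) (lam : F) : F :=
  n`!%:R * fps_exp (korobov_gen lam) m n.

(* a_j(N); only the values with j <= N are meaningful. *)
Fixpoint acoef (lam : F) (j N : nat) : F :=
  if j is k.+1 then
    j%:R * lam *
      \sum_(0 <= i < (N - j).+1)
        falling (N%:R + j.+1%:R * lam - 1) i * acoef lam k (N - i - 1)%N
  else if N is 0 then lam^-1 else falling (N%:R + lam - 1) N.-1.

Lemma size_fps_div_seq f g n : size (fps_div_seq f g n) = n.
Proof. by elim: n => //= n IHn; rewrite size_rcons IHn. Qed.

Lemma nth_fps_div_seq f g n i :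
  (i < n)%N -> (fps_div_seq f g n)`_i = fps_div f g i.
Proof.
elim: n => // n IHn; rewrite ltnS leq_eqVlt => /orP[/eqP-> // | lt_in].
by rewrite /= nth_rcons size_fps_div_seq lt_in IHn.
Qed.

Lemma fps_divK f g : g 0%N != 0 -> fps_mul g (fps_div f g) =1 f.
Proof.
move=> g0 n; rewrite /fps_mul (reindex_inj rev_ord_inj) /=.
rewrite big_ord_recr /= subSS subnn subn0.
rewrite {2}/fps_div /= nth_rcons size_fps_div_seq ltnn eqxx mulrC divfK //.
rewrite [X in X + _](_ : _ = \sum_(i < n) g (n - i)%N * (fps_div_seq f g n)`_i).
  by rewrite addrC subrK.
apply: eq_bigr => i _.
by rewrite subSS subKn ?nth_fps_div_seq // ltnW.
Qed.

(* ((1 + t)^lam - 1) * (lam t / ((1 + t)^lam - 1)) = lam t *)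
Lemma korobov_genP lam : lam != 0 ->
  fps_mul (korobov_den lam) (korobov_gen lam) =1 korobov_num lam.
Proof.
move=> lam0.
have den0 : korobov_den lam 0%N = 0.
  by rewrite /korobov_den /binomial_series /falling big_ord0 divr1 subrr.
have den1 : fps_shift (korobov_den lam) 0%N != 0.
  rewrite /fps_shift /korobov_den /binomial_series /falling /fps_one.
  by rewrite big_ord_recl big_ord0 mulr1 !subr0 divr1.
case=> [|n].
  by rewrite /fps_mul big_ord_recl big_ord0 den0 mul0r add0r /korobov_num mulr0.
rewrite /fps_mul big_ord_recl den0 mul0r add0r.
exact: (fps_divK (fps_shift (korobov_num lam)) den1 n).
Qed.

End Defs.

(* Main.v *)
Require Import Defs.
From mathcomp Require Import all_boot all_order all_algebra ring zify.

Set Implicit Arguments.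
Unset Strict Implicit.
Unset Printing Implicit Defensive.

Import GRing.Theory Num.Theory.
Local Open Scope ring_scope.

(** Write [theta = t d/dt].  From [((1+t)^lam - 1) K = lam t] one gets the
    regular differential equation
      [(1+t) theta K = (1+t) K - lam t K - K^2]
    for the Korobov generating function [K].  With [F = 1/((1+t)^lam - 1)], so
    that [K = lam t F], put
      [G_N = (-1)^N lam t^(N+1) (1+t)^N F^(N)].
    Then [G_0 = K] and
      [G_(N+1) = (1+t) ((N+1) G_N - theta G_N) + N t G_N].
    The series [\sum_i lam^(i-N+1) a_(N-i)(N) t^i K^(N+1-i)] obeys this
    recurrence because of the differential equation and the recurrence
      [a_j(N+1) = (N + (j+1) lam) a_j(N) + j lam a_(j-1)(N)],
    and so does [(1+t)^N (-1)^N (theta - 1) ... (theta - N) K].  The theorem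
    equates their coefficients of [t^n] (times [n!]).  Power series are handled
    as polynomials modulo a power of ['X]. *)

(** * Truncated power series and the operator [t d/dt] *)

Section Truncation.
Variable F : numFieldType.
Implicit Types (p q : {poly F}) (M : nat).

Lemma dvdXnP M p : reflect (forall i, (i < M)%N -> p`_i = 0) ('X^M %| p).
Proof.
apply: (iffP idP) => [/dvdpP[q ->] i ltiM | p0]; first by rewrite coefMXn ltiM.
rewrite -(poly_take_drop M p).
have -> : take_poly M p = 0.
  by apply/polyP => i; rewrite coef_take_poly coef0; case: ltnP => // /p0.
by rewrite add0r dvdp_mull.
Qed.

(** Unlike the plain derivative, this operator acts diagonally on coefficients, so no precision is
    lost modulo ['X^M]. *)
Definition euler p : {poly F} := 'X * p^`().

Lemma coef_euler p i : (euler p)`_i = i%:R * p`_i.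
Proof. by rewrite coefXM coef_deriv; case: i => [|i] /=; rewrite ?mul0r ?mulr_natl. Qed.

Lemma eulerD p q : euler (p + q) = euler p + euler q.
Proof. by rewrite /euler derivD mulrDr. Qed.

Lemma eulerM p q : euler (p * q) = euler p * q + p * euler q.
Proof. by rewrite /euler derivM; ring. Qed.

Lemma eulerC (c : F) : euler c%:P = 0.
Proof. by rewrite /euler derivC mulr0. Qed.

Lemma eulerXn i : euler 'X^i = i%:R * 'X^i.
Proof.
apply/polyP => j; rewrite coef_euler -polyC_natr coefCM coefXn.
by case: eqP => [->|]; rewrite ?mulr0.
Qed.

Lemma eulerX p m : euler (p ^+ m.+1) = m.+1%:R * p ^+ m * euler p.
Proof. by rewrite /euler deriv_exp -mulr_natl /=; ring. Qed.

Lemma dvdXn_euler M p : 'X^M %| p -> 'X^M %| euler p.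
Proof. by move=> /dvdXnP p0; apply/dvdXnP => i /p0; rewrite coef_euler => ->; rewrite mulr0. Qed.

Lemma coef_fps_exp (f : nat -> F) M m i : (i < M)%N ->
  fps_exp f m i = ((\poly_(j < M) f j) ^+ m)`_i.
Proof.
elim: m i => [|m IHm] i ltiM; first by rewrite expr0 coef1.
rewrite exprS coefM /fps_exp iterS /fps_mul; apply: eq_bigr => j _.
rewrite coef_poly (leq_ltn_trans _ ltiM) ?leq_ord // -IHm //.
exact: leq_ltn_trans (leq_subr _ _) ltiM.
Qed.

End Truncation.

(** * Falling factorials and the coefficients [a_j(N)] *)

Section Coefficients.
Variables (F : numFieldType) (lam : F).
Hypothesis lam_neq0 : lam != 0.

Lemma fallingS (x : F) n : falling x n.+1 = x * falling (x - 1) n.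
Proof.
rewrite /falling big_ord_recl subr0; congr (_ * _); apply: eq_bigr => i _.
by rewrite lift0 -addn1 natrD; ring.
Qed.

Lemma fallingSr (x : F) n : falling x n.+1 = falling x n * (x - n%:R).
Proof. by rewrite /falling big_ord_recr. Qed.

Lemma falling_nat0 m n : (m < n)%N -> falling (m%:R : F) n = 0.
Proof. by move=> ltmn; rewrite /falling (bigD1 (Ordinal ltmn)) //= subrr mul0r. Qed.

Lemma falling_nat m n : falling (m%:R : F) n = (m ^_ n)%:R.
Proof.
elim: n m => [|n IHn] m; first by rewrite /falling big_ord0.
case: m => [|m]; first by rewrite falling_nat0.
have mE : m.+1%:R - 1 = m%:R :> F by rewrite -natr1 addrK.
by rewrite fallingS mE ffactSS natrM IHn.
Qed.

Lemma falling_opp1 n : falling (-1 : F) n = (-1) ^+ n * n`!%:R.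
Proof.
elim: n => [|n IHn]; first by rewrite /falling big_ord0 expr0 mul1r.
by rewrite fallingSr IHn exprS factS natrM -natr1; ring.
Qed.

Lemma acoef0S N : acoef lam 0 N.+1 = (N%:R + lam) * acoef lam 0 N.
Proof.
case: N => [|N] /=; first by rewrite add0r mulfV // /falling big_ord0.
rewrite fallingS -!natr1; congr (_ * falling _ _); ring.
Qed.

Lemma acoef_diag j : acoef lam j.+1 j.+1 = j.+1%:R * lam * acoef lam j j.
Proof.
by rewrite /= subnn big_nat1 /falling big_ord0 mul1r subn0 subn1.
Qed.

(** The term [i = 0] of the defining sum gives [acoef lam j N]. The other terms share the first
    factor of their falling factorials, and what remains is the sum defining [acoef lam j.+1 N]. *)
Lemma acoefSS j N : (j < N)%N ->
  acoef lam j.+1 N.+1 =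
  (N%:R + j.+2%:R * lam) * acoef lam j.+1 N + j.+1%:R * lam * acoef lam j N.
Proof.
move=> ltjN; rewrite /= subSS.
have -> : (N - j).+1 = (N - j.+1).+2 by rewrite subnSK.
rewrite big_nat_recl // {1}/falling big_ord0 mul1r subn0 subn1 /=.
rewrite mulrDr addrC; congr (_ + _).
rewrite mulrCA; congr (_ * _); rewrite mulr_sumr.
apply: eq_bigr => i _; rewrite fallingS subSS mulrA.
by congr (_ * falling _ _ * _); rewrite -!natr1; ring.
Qed.

(** Coefficient of [t^i K^(N+1-i)] in the left-hand series; the power of [lam] absorbs the factor
    [lam] in the last term of [acoefSS]. *)
Definition ccoef i N : F := lam ^ (i%:Z - N%:Z + 1) * acoef lam (N - i) N.

Lemma ccoef00 : ccoef 0 0 = 1.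
Proof. by rewrite /ccoef /= expr1z mulfV. Qed.

Lemma ccoef0S N : ccoef 0 N.+1 = N.+1%:R * ccoef 0 N.
Proof.
rewrite /ccoef !subn0 acoef_diag.
have -> : 0%:Z - N%:Z + 1 = (0%:Z - N.+1%:Z + 1) + 1 by rewrite (intS N); ring.
by rewrite [in RHS]expfzDr // expr1z; ring.
Qed.

Lemma ccoefSS i N : (i < N)%N ->
  ccoef i.+1 N.+1 =
  (N%:R + (N.+1 - i)%:R * lam) * ccoef i N + (N - i)%:R * ccoef i.+1 N.
Proof.
move=> ltiN; rewrite /ccoef subSS.
have [j defj] : exists j, (N - i = j.+1)%N by exists (N - i).-1; rewrite prednK // subn_gt0.
rewrite subSn ?(ltnW ltiN) // subnS defj succnK acoefSS; last first.
  by rewrite -defj leq_subr.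
have -> : i.+1%:Z - N%:Z + 1 = (i%:Z - N%:Z + 1) + 1 by rewrite (intS i); ring.
have -> : i.+1%:Z - N.+1%:Z + 1 = i%:Z - N%:Z + 1 by rewrite (intS i) (intS N); ring.
by rewrite (expfzDr (i%:Z - N%:Z + 1) 1) // expr1z -!natr1; ring.
Qed.

Lemma ccoefS_diag N : ccoef N.+1 N.+1 = (N%:R + lam) * ccoef N N.
Proof. by rewrite /ccoef !subrr !subnn acoef0S mulrCA. Qed.

End Coefficients.

(** * The differential equation of the Korobov series *)

Section KorobovODE.
Variables (F : numFieldType) (lam : F) (M : nat).
Hypothesis lam_neq0 : lam != 0.

Let K : {poly F} := \poly_(i < M.+1) korobov_gen lam i.
Let D : {poly F} := \poly_(i < M.+1) korobov_den lam i.

(** Coefficient form of [(1+t) y' = lam y] for [y = (1+t)^lam]. *)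
Lemma binomial_seriesS n :
  n.+1%:R * binomial_series lam n.+1 = (lam - n%:R) * binomial_series lam n.
Proof.
rewrite /binomial_series fallingSr factS natrM.
have n1 : n.+1%:R != 0 :> F by rewrite pnatr_eq0.
by rewrite invfM [_ * (_^-1 * _)]mulrCA mulVKf // mulrAC mulrC.
Qed.

Lemma korobov_den0 : korobov_den lam 0 = 0.
Proof. by rewrite /korobov_den /binomial_series /falling big_ord0 divr1 subrr. Qed.

(* The case [n = 0] carries the extra term [lam] because [korobov_den] is the
   binomial series without its constant term. *)
Lemma korobov_denS n :
  n.+1%:R * korobov_den lam n.+1 =
  (lam - n%:R) * korobov_den lam n + lam * (n == 0%N)%:R.
Proof.
rewrite /korobov_den /fps_one /= subr0 binomial_seriesS.
by case: n => [|n] /=; ring.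
Qed.

Lemma korobov_gen0 : korobov_gen lam 0 = 1.
Proof.
have := korobov_genP lam_neq0 1.
rewrite /fps_mul big_ord_recl big_ord1 /= /korobov_num mulr1 korobov_den0 mul0r add0r.
have := korobov_denS 0; rewrite korobov_den0 mulr0 add0r mul1r mulr1 => ->.
by rewrite -[RHS]mulr1 => /(mulfI lam_neq0).
Qed.

Lemma dvdXn_DK : 'X^(M.+1) %| D * K - lam%:P * 'X.
Proof.
apply/dvdXnP => i lti; rewrite coefB coefM coefCM coefX.
apply/eqP; rewrite subr_eq0; apply/eqP.
rewrite -[RHS](korobov_genP lam_neq0 i); apply: eq_bigr => j _.
rewrite !coef_poly (leq_ltn_trans _ lti) ?leq_ord //.
by rewrite (leq_ltn_trans _ lti) ?leq_subr.
Qed.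

Lemma dvdXn_eulerD : 'X^(M.+1) %| (1 + 'X) * euler D - lam%:P * 'X * (D + 1).
Proof.
apply/dvdXnP => i lti.
rewrite mulrDl mul1r -mulrA coefB coefD coefCM coef_euler coefXM (coef_euler _ i.-1).
rewrite coefXM coefD coef1.
rewrite !coef_poly lti; case: i lti => [|i] lti /=; first by rewrite mul0r mulr0; ring.
by rewrite (ltnW lti) korobov_denS; ring.
Qed.

Definition korobov_ode (k : {poly F}) : {poly F} :=
  (1 + 'X) * euler k - ((1 + 'X) * k - lam%:P * 'X * k - k ^+ 2).

Lemma dvdXn_ode : 'X^M %| korobov_ode K.
Proof.
(* For [M = 0] the truncation [D] is zero and cannot be cancelled. *)
case: (posnP M) => [->|M_gt0]; first by rewrite expr0 dvd1p.
have dvdDE : 'X^(M.+1) %| D * korobov_ode K.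
  (* [A] and [B] are the defects of [D K = lam t] and of the equation for [D]; both vanish modulo
     ['X^(M.+1)]. *)
  set A := D * K - lam%:P * 'X; set B := (1 + 'X) * euler D - lam%:P * 'X * (D + 1).
  have -> : D * korobov_ode K = (1 + 'X) * euler A + K * (A - B) - (1 + 'X) * A.
    have -> : euler A = euler D * K + D * euler K - lam%:P * 'X.
      by rewrite /A /euler derivB !derivM derivC derivX; ring.
    by rewrite /A /B /korobov_ode; ring.
  have dvdA : 'X^(M.+1) %| A by exact: dvdXn_DK.
  have dvdB : 'X^(M.+1) %| B by exact: dvdXn_eulerD.
  apply: dvdp_sub; last exact: dvdp_mull.
  apply: dvdp_add; first exact/dvdp_mull/dvdXn_euler.
  exact/dvdp_mull/dvdp_sub.
(* Cancelling [D] costs one power of ['X]; the cofactor [D'] is prime to ['X] because its constant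
   term is [lam]. *)
have [D' defD D'0] : exists2 D', D = 'X * D' & D'`_0 = lam.
  exists (\poly_(i < M) korobov_den lam i.+1).
    apply/polyP => -[|i]; rewrite coefXM !coef_poly //=; exact: korobov_den0.
  rewrite coef_poly M_gt0; have := korobov_denS 0.
  by rewrite korobov_den0 mulr0 add0r mul1r mulr1.
move: dvdDE; rewrite defD exprS -mulrA dvdp_mul2l ?polyX_eq0 // Gauss_dvdpr //.
by rewrite coprimep_expl // coprimep_sym coprimepX rootE horner_coef0 D'0.
Qed.

End KorobovODE.

(** * The recurrence in [N] shared by both sides *)

Section Recurrence.
Variables (F : numFieldType) (lam : F).
Hypothesis lam_neq0 : lam != 0.
Implicit Types (k p q : {poly F}) (N M : nat).

(* If [p] is [t^(N+1) (1+t)^N (-d/dt)^N f], this is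
   [t^(N+2) (1+t)^(N+1) (-d/dt)^(N+1) f]. *)
Definition dstep N p : {poly F} :=
  (1 + 'X) * (N.+1%:R * p - euler p) + N%:R * 'X * p.

Lemma dstepD N p q : dstep N (p + q) = dstep N p + dstep N q.
Proof. by rewrite /dstep eulerD; ring. Qed.

Lemma dstepCM N (c : F) p : dstep N (c%:P * p) = c%:P * dstep N p.
Proof. by rewrite /dstep eulerM eulerC; ring. Qed.

Lemma dstep_sum N n (f : nat -> {poly F}) :
  dstep N (\sum_(i < n) f i) = \sum_(i < n) dstep N (f i).
Proof.
apply: (big_morph (dstep N)) => [p q|]; first exact: dstepD.
by rewrite /dstep /euler derivC; ring.
Qed.

Lemma dvdXn_dstep N M p : 'X^M %| p -> 'X^M %| dstep N p.
Proof.
move=> dp; apply: dvdp_add; last exact: dvdp_mull.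
by apply/dvdp_mull/dvdp_sub; [apply: dvdp_mull | apply: dvdXn_euler].
Qed.

(** Once [(1 + 'X) * euler k] is replaced through the differential equation, the remaining multiple
    of [1 + 'X] carries the factor [N - i - m = 0]. The last term keeps the defect of [k], so the
    identity is exact. *)
Lemma dstep_monomial N k i m : (i + m = N)%N ->
  dstep N ('X^i * k ^+ m.+1) =
  (N%:R + m.+1%:R * lam)%:P * ('X^(i.+1) * k ^+ m.+1) + m.+1%:R * ('X^i * k ^+ m.+2)
  - m.+1%:R * 'X^i * k ^+ m * korobov_ode lam k.
Proof.
move=> <-; rewrite /dstep /korobov_ode eulerM eulerXn eulerX.
rewrite polyCD polyCM !polyC_natr !exprS -!natr1 natrD; ring.
Qed.

Definition lhs_poly k N : {poly F} :=
  \sum_(i < N.+1) (ccoef lam i N)%:P * ('X^i * k ^+ (N.+1 - i)).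

Lemma lhs_polyS k N M : 'X^M %| korobov_ode lam k ->
  'X^M %| lhs_poly k N.+1 - dstep N (lhs_poly k N).
Proof.
move=> dvdE.
pose G i : {poly F} := (N%:R + (N.+1 - i)%:R * lam)%:P * ('X^(i.+1) * k ^+ (N.+1 - i)).
pose H i : {poly F} := (N.+1 - i)%:R * ('X^i * k ^+ (N.+2 - i)).
pose R i : {poly F} := (N.+1 - i)%:R * 'X^i * k ^+ (N - i).
have -> : dstep N (lhs_poly k N) =
    \sum_(i < N.+1) (ccoef lam i N)%:P * (G i + H i)
    - (\sum_(i < N.+1) (ccoef lam i N)%:P * R i) * korobov_ode lam k.
  rewrite /lhs_poly (dstep_sum _ _ (fun i => (ccoef lam i N)%:P * ('X^i * k ^+ (N.+1 - i)))).
  rewrite mulr_suml -sumrB; apply: eq_bigr => i _; have leiN := leq_ord i.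
  rewrite dstepCM /G /H /R !subSn ?(leqW leiN) // dstep_monomial ?subnKC //.
  ring.
suff -> : lhs_poly k N.+1 = \sum_(i < N.+1) (ccoef lam i N)%:P * (G i + H i).
  by rewrite opprB addrC subrK dvdp_mull.
(* [H 0] gives the first term and [G N] the last; in between, [G i] and [H i.+1] are multiples of
   the same monomial and combine by [ccoefSS]. *)
rewrite /lhs_poly big_ord_recl big_ord_recr /=.
under [RHS]eq_bigr do rewrite mulrDr.
rewrite big_split /= [X in _ = X + _]big_ord_recr [X in _ = _ + X]big_ord_recl /=.
rewrite [RHS]addrC -!addrA; congr (_ + _).
  by rewrite ccoef0S // polyCM polyC_natr /H !subn0; ring.
rewrite addrA; congr (_ + _); last first.
  by rewrite ccoefS_diag // /G polyCM !subSS !subSn ?leqnn // !subnn mul1r; ring.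
rewrite -big_split; apply: eq_bigr => i _ /=.
rewrite ccoefSS // /G /H polyCD !polyCM polyC_natr !subSS.
by ring.
Qed.

(* For [i = 0] the factor is [N!], and it vanishes for [0 < i <= N]: this one
   formula gives both cases of the theorem. *)
Definition rhs_coef (f : nat -> F) N i : F := (-1) ^+ N * falling (i%:R - 1) N * f i.

Definition rhs_poly (f : nat -> F) M N : {poly F} :=
  (1 + 'X) ^+ N * \poly_(i < M) rhs_coef f N i.

(** The term [N t p] of [dstep] cancels the derivative of [(1+t)^N]. What is left is [N+1-theta],
    which multiplies [t^i] by [-(i-1-N)]: the next factor of the falling factorial, with its
    sign. *)
Lemma rhs_polyS f M N : rhs_poly f M N.+1 = dstep N (rhs_poly f M N).
Proof.
rewrite /rhs_poly; set p := \poly_(i < M) rhs_coef f N i.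
have -> : \poly_(i < M) rhs_coef f N.+1 i = N.+1%:R * p - euler p.
  apply/polyP => i; rewrite coefB coef_euler -polyC_natr coefCM !coef_poly.
  case: ifP => _; last by ring.
  by rewrite /rhs_coef fallingSr exprS -natr1; ring.
rewrite /dstep eulerM.
case: N @p => [|N] p; first by rewrite expr0 /euler derivC; ring.
rewrite eulerX /euler derivD derivX derivC !exprS; ring.
Qed.

Lemma lhs_rhs_poly f L M N : 'X^M %| korobov_ode lam (\poly_(i < L) f i) ->
  'X^M %| lhs_poly (\poly_(i < L) f i) N - rhs_poly f L N.
Proof.
set k := \poly_(i < L) f i => ode; elim: N => [|N IHN].
  rewrite /lhs_poly big_ord1 ccoef00 // /rhs_poly !expr0 !mul1r expr1.
  rewrite (_ : \poly_(i < L) _ = k) ?subrr ?dvdp0 //.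
  by apply/polyP => i; rewrite !coef_poly /rhs_coef /falling big_ord0 !mul1r.
have -> : lhs_poly k N.+1 - rhs_poly f L N.+1 =
  (lhs_poly k N.+1 - dstep N (lhs_poly k N)) + dstep N (lhs_poly k N - rhs_poly f L N).
  rewrite rhs_polyS -mulN1r -polyCN -[X in dstep N (_ + X)]mulN1r.
  by rewrite -polyC1 -polyCN dstepD dstepCM polyCN; ring.
by rewrite dvdp_add ?lhs_polyS ?dvdXn_dstep.
Qed.

End Recurrence.

(** * Coefficients of [t^n] on both sides *)

Section CoefficientFormulas.
Variables (F : numFieldType) (lam : F).

Lemma coef_add1Xn N l : ((1 + 'X : {poly F}) ^+ N)`_l = 'C(N, l)%:R.
Proof.
elim: N l => [|N IHN] l; first by rewrite expr0 coef1 bin0n.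
rewrite exprS mulrDl mul1r coefD coefXM !IHN.
by case: l => [|l] /=; rewrite ?bin0 ?addr0 // binS natrD.
Qed.

Lemma coef_rhs_poly (f : nat -> F) L N n : (n < L)%N ->
  (rhs_poly f L N)`_n = \sum_(0 <= l < n.+1) 'C(N, l)%:R * rhs_coef f N (n - l).
Proof.
move=> ltnL; rewrite coefM big_mkord; apply: eq_bigr => l _.
by rewrite coef_add1Xn coef_poly (leq_ltn_trans (leq_subr _ _) ltnL).
Qed.

Lemma rhs_coef_eq0 (f : nat -> F) N i : (0 < i <= N)%N -> rhs_coef f N i = 0.
Proof.
case: i => // i /andP[_ ltiN].
by rewrite /rhs_coef -natr1 addrK falling_nat0 // mulr0 mul0r.
Qed.

(** Terms with [i > n] have no [t^n]; in the others [n! = (n)_i (n-i)!] makes the Korobov numbers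
    appear. *)
Lemma coef_lhs_poly L N n : (n < L)%N ->
  n`!%:R * (lhs_poly lam (\poly_(i < L) korobov_gen lam i) N)`_n =
  \sum_(0 <= i < (minn n N).+1)
     lam ^ (i%:Z - N%:Z + 1) * (n ^_ i)%:R * acoef lam (N - i) N
       * korobov (N + 1 - i) (n - i) lam.
Proof.
move=> ltnL; rewrite coef_sum.
under eq_bigr do rewrite coefCM coefXnM.
set k := \poly_(i < L) _.
rewrite -(big_mkord xpredT (fun i => ccoef lam i N *
  (if (n < i)%N then 0 else (k ^+ (N.+1 - i))`_(n - i)))).
rewrite (@big_cat_nat _ _ _ (minn n N).+1) ?ltnS ?geq_minr //=.
rewrite [X in _ * (_ + X)]big_nat_cond [X in _ * (_ + X)]big1 => [|i]; last first.
  rewrite andbT gtn_min => /andP[/orP[->|ltNi] leiN]; first by rewrite mulr0.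
  by rewrite ltnNge -ltnS leiN in ltNi.
rewrite addr0 mulr_sumr; apply: eq_big_nat => i /andP[_].
rewrite ltnS leq_min => /andP[lein _].
rewrite ltnNge lein /= /korobov addn1 (coef_fps_exp _ _ (leq_ltn_trans (leq_subr i n) ltnL)).
by rewrite -(ffact_fact lein) natrM /ccoef; ring.
Qed.

End CoefficientFormulas.

Theorem theorem4 (F : numFieldType) (lam : F) (lam_neq0 : lam <> 0)
    (N n : nat) (N_ge1 : (1 <= N)%N) :
  \sum_(0 <= i < (minn n N).+1)
     lam ^ (i%:Z - N%:Z + 1) * (n ^_ i)%:R * acoef lam (N - i) N
       * korobov (N + 1 - i) (n - i) lam
  = if (n <= N)%N then N`!%:R * (N ^_ n)%:R
    else (-1) ^+ N *
      \sum_(0 <= l < n - N)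
         'C(N, l)%:R * (korobov 1 (n - l) lam / (n - l)%:R)
           * (n ^_ (N + 1 + l))%:R.
Proof.
have lam0 : lam != 0 by apply/eqP.
(* Truncating at [n.+2] yields the differential equation modulo ['X^(n.+1)], which still sees
   [t^n]. *)
have ltn2 : (n < n.+2)%N by rewrite ltnS leqnSn.
rewrite -(coef_lhs_poly lam N ltn2).
have /dvdXnP/(_ n (ltnSn n)) := lhs_rhs_poly lam0 N (dvdXn_ode n.+1 lam0).
move/eqP; rewrite coefB subr_eq0 coef_rhs_poly // => /eqP ->.
case: leqP => [lenN | ltNn].
  (* Only [l = n] survives, where the falling factorial of [-1] gives [(-1)^N N!]. *)
  rewrite big_nat_recr //= subnn big_nat big1 => [|l /andP[_ ltln]]; last first.
    rewrite rhs_coef_eq0 ?mulr0 // subn_gt0 ltln.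
    exact: leq_trans (leq_subr _ _) lenN.
  rewrite add0r /rhs_coef sub0r falling_opp1 korobov_gen0 // mulr1.
  by rewrite mulrA -signr_odd -expr2 sqrr_sign mul1r -bin_ffact natrM; ring.
(* For [l >= n - N] all terms vanish: the binomial does at [l = n], and [rhs_coef] does when
   [0 < n - l <= N]. *)
rewrite (@big_cat_nat _ _ _ (n - N)) ?leqW ?leq_subr //=.
rewrite [X in _ * (_ + X)]big_nat [X in _ * (_ + X)]big1 => [|l /andP[leNl]]; last first.
  rewrite ltnS leq_eqVlt => /predU1P[->|ltln]; first by rewrite bin_small ?mul0r.
  by rewrite rhs_coef_eq0 ?mulr0 // subn_gt0 ltln leq_subLR addnC -leq_subLR.
rewrite addr0 !mulr_sumr; apply: eq_big_nat => l /andP[_ ltl].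
have [m defm] : exists m, (n - l = (N + m).+1)%N.
  exists (n - l - N.+1)%N; rewrite -addSn subnKC //.
  by rewrite ltn_subRL addnC -ltn_subRL.
have leln : (l <= n)%N by apply: ltnW; apply: leq_trans ltl (leq_subr _ _).
rewrite /rhs_coef /korobov (coef_fps_exp _ 1 (ltnSn (n - l))) expr1 coef_poly ltnSn.
rewrite defm -[(N + m).+1%:R]natr1 addrK falling_nat.
have defn : (n - (N + 1 + l) = m)%N.
  by rewrite addn1 addnC subnDA defm -addSn addKn.
have len : (N + 1 + l <= n)%N by rewrite addn1 addnC -leq_subRL // defm ltnS leq_addr.
(* Both sides equal [n! (N+m+1)! / m!]. *)
have key : (n`! * (N + m) ^_ N * (N + m).+1 = (N + m).+1`! * n ^_ (N + 1 + l))%N.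
  rewrite -(ffact_fact len) defn factS -(ffact_fact (leq_addr m N)) addKn; lia.
have y0 : (N + m).+1%:R != 0 :> F by rewrite pnatr_eq0.
have keyF : n`!%:R * ((N + m) ^_ N)%:R =
    (N + m).+1`!%:R * (n ^_ (N + 1 + l))%:R / (N + m).+1%:R :> F.
  by apply: (canRL (mulfK y0)); rewrite -!natrM key.
transitivity ((-1) ^+ N * 'C(N, l)%:R * korobov_gen lam (N + m).+1 *
    (n`!%:R * ((N + m) ^_ N)%:R)); first by ring.
by rewrite keyF natr1; ring.
Qed.
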